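(* A locally compact Hausdorff space is paracompact if and only if it admits a partition $\mathcal Q$ by clopen, $\sigma$-compact subsets. If $f$ is a proper closed relation on a locally compact, paracompact Hausdorff space $X$, then $X$ admits a partition $\mathcal Q$ by clopen, $\sigma$-compact subsets each of which is +invariant for $f$ and $f^{-1}$.
   Context: A relation $f$ on $X$ is a subset of $X\times X$; $f(A)=\{y:(x,y)\in f\text{ for some }x\in A\}$ and $f^{-1}=\{(y,x):(x,y)\in f\}$. $f$ is a proper closed relation if it is closed in $X\times X$ and both $f(A)$ and $f^{-1}(A)$ are compact for every compact $A\subset X$. A set $Q$ is +invariant for $f$ if $f(Q)\subset Q$. *)

(* Defs.v *)
From HB Require Import structures.
From mathcomp Require Import all_boot all_order all_algebra.
From mathcomp Require Import all_classical all_reals all_analysis.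

Set Implicit Arguments.
Unset Strict Implicit.
Unset Printing Implicit Defensive.

Local Open Scope classical_set_scope.

Definition rel_image (X : Type) (f : set (X * X)) (A : set X) : set X :=
  [set y | exists2 x, A x & f (x, y)].

Definition plus_invariant (X : Type) (f : set (X * X)) (Q : set X) : Prop :=
  rel_image f Q `<=` Q.

Definition proper_closed_relation (X : topologicalType) (f : set (X * X)) :
    Prop :=
  closed f /\
  forall A : set X, compact A ->
    compact (rel_image f A) /\ compact (rel_image (f^-1)%relation A).

Definition sigma_compact (X : topologicalType) (A : set X) : Prop :=
  exists2 K : nat -> set X, (forall n, compact (K n)) & A = \bigcup_n K n.

Definition open_cover (X : topologicalType) (U : set (set X)) : Prop :=
  U `<=` open /\ cover U id = [set: X].

Definition refines (X : Type) (V U : set (set X)) : Prop :=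
  forall A, V A -> exists2 B, U B & A `<=` B.

Definition locally_finite (X : topologicalType) (V : set (set X)) : Prop :=
  forall x : X, exists2 N, nbhs x N &
    finite_set [set A | V A /\ A `&` N !=set0].

(* No separation axiom is included: Hausdorffness is a separate hypothesis. *)
Definition paracompact (X : topologicalType) : Prop :=
  forall U : set (set X), open_cover U ->
    exists V : set (set X), [/\ open_cover V, refines V U & locally_finite V].

(* Main.v *)
Require Import Defs.
From HB Require Import structures.
From mathcomp Require Import all_boot all_order all_algebra.
From mathcomp Require Import all_classical all_reals all_analysis.

(** Given a locally finite open cover [V] by relatively compact sets, let [r]
    relate [x] and [y] when [(x, y)] lies in [f], in its inverse, or in [A x A]
    for some [A] in [V].  A compact set meets finitely many members of [V], so
    its [r]-image lies in a compact set; hence the classes of the equivalence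
    relation generated by [r] are sigma-compact.  They are open since each
    contains every member of [V] that it meets, and closed since the complement
    of a class is a union of classes.  Taking [f] empty gives the first half of
    the characterization of paracompactness.  Conversely, a clopen
    sigma-compact set has an exhaustion by compact sets [L n], each inside the
    interior of the next; refining a cover separately on each shell
    [L n.+1 `\` interior (L n)], within the complement of [L n.-1], gives a
    locally finite family. *)

Set Implicit Arguments.
Unset Strict Implicit.
Unset Printing Implicit Defensive.

Local Open Scope classical_set_scope.

(** * Induction on compact sets, and finite subcovers *)

(* If [P K] failed, the sets [B] with [P (K `\` B)] would form a proper filter
   with no cluster point in [K]. *)
Lemma compact_ind (X : topologicalType) (P : set X -> Prop) (K : set X) :
  P set0 ->
  (forall A B, A `<=` B -> P B -> P A) ->
  (forall A B, P A -> P B -> P (A `|` B)) ->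
  (forall x, K x -> exists2 N, nbhs x N & P N) ->
  compact K -> P K.
Proof.
move=> P0 Psub PU Ploc cK; apply: contrapT => nPK.
pose F : set_system X := [set B | P (K `\` B)].
have FF : ProperFilter F.
  split; first by rewrite /F /= setD0.
  split; first by rewrite /F /= setDT.
    by move=> B C FB FC; rewrite /F /= setDIr; exact: PU.
  by move=> B C BC; apply: Psub => y [Ky nCy]; split=> // /BC.
have [|x [Kx Fx]] := cK F FF.
  by rewrite /F /= setDv.
have [N xN PN] := Ploc x Kx.
have FN : F (~` N) by apply: Psub PN => y [_ /contrapT].
by have [y [nNy /nNy]] := Fx _ _ FN xN.
Qed.

Lemma compact_finite_subcover (X : topologicalType) (K : set X)
    (D : set (set X)) :
  compact K -> D `<=` open -> K `<=` cover D id ->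
  exists W : set (set X), [/\ finite_set W, W `<=` D & K `<=` cover W id].
Proof.
move=> cK Dop KD.
apply: (@compact_ind X (fun S => exists W : set (set X),
  [/\ finite_set W, W `<=` D & S `<=` cover W id])) cK.
- by exists set0; split=> //; exact: sub0set.
- by move=> A B AB [W [fW WD BW]]; exists W; split=> //; exact: subset_trans BW.
- move=> A B [W [fW WD AW]] [W' [fW' WD' BW']]; exists (W `|` W'); split.
  + by rewrite finite_setU.
  + by move=> C [/WD|/WD'].
  + move=> x [/AW|/BW'] [C WC Cx]; exists C => //; by [left|right].
- move=> x /KD[B DB Bx]; exists B.
    by apply: open_nbhs_nbhs; split=> //; exact: Dop.
  exists [set B]; split; [exact: finite_set1|by move=> _ ->|].
  by move=> y By; exists B.
Qed.

Lemma bigcup_sub_compact (X : topologicalType) (V : set (set X)) :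
  finite_set V ->
  (forall A, V A -> exists2 C, compact C & A `<=` C) ->
  exists2 C, compact C & \bigcup_(A in V) A `<=` C.
Proof.
move=> /finite_seqP[s ->]; elim: s => [|A s IH] bV.
  by exists set0; [exact: compact0|move=> x []].
have [|C cC sC] := IH.
  by move=> B sB; apply: bV => /=; rewrite inE sB orbT.
have [|C' cC' AC'] := bV A; first by rewrite /= inE eqxx.
exists (C' `|` C); first exact: compactU.
move=> x [B /=]; rewrite inE => /orP[/eqP ->|sB] Bx; first by left; exact: AC'.
by right; apply: sC; exists B.
Qed.

Lemma locally_compact_compact_nbhs (X : topologicalType) (x : X) :
  locally_compact [set: X] -> exists2 C, nbhs x C & compact C.
Proof.
move=> /(_ x I)[C xC [cC _]]; exists C => //.
move: xC; rewrite /within /=; apply: filterS => y; exact.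
Qed.

(** * Classes of a symmetric relation *)

Lemma plus_invariantC (X : Type) (r : set (X * X)) (A : set X) :
  (forall x y, r (x, y) -> r (y, x)) ->
  plus_invariant r A -> plus_invariant r (~` A).
Proof.
move=> rC iA y [x nAx rxy] Ay; apply: nAx; apply: iA; exists y => //.
exact: rC.
Qed.

Lemma plus_invariant_open (X : topologicalType) (r : set (X * X)) (A : set X) :
  (forall x, nbhs x [set y | r (x, y)]) -> plus_invariant r A -> open A.
Proof.
move=> rN iA; rewrite openE => x Ax.
by apply: filterS (rN x) => y rxy; apply: iA; exists x.
Qed.

(* For symmetric [r] these are the classes of the equivalence relation that [r]
   generates, since complements of [r]-invariant sets are then invariant. *)
Definition orbit (X : Type) (r : set (X * X)) (x : X) : set X :=
  smallest (plus_invariant r) [set x].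

Lemma orbit_refl (X : Type) (r : set (X * X)) (x : X) : orbit r x x.
Proof. exact: sub_gen_smallest. Qed.

Lemma orbit_sub (X : Type) (r : set (X * X)) (x : X) (A : set X) :
  plus_invariant r A -> A x -> orbit r x `<=` A.
Proof. by move=> iA Ax; apply: smallest_sub => // _ ->. Qed.

Lemma orbit_invariant (X : Type) (r : set (X * X)) (x : X) :
  plus_invariant r (orbit r x).
Proof.
by move=> z [y oy ryz] A iA; apply: (iA.1); exists y => //; exact: oy.
Qed.

Lemma orbit_eq (X : Type) (r : set (X * X)) (x y : X) :
  (forall x y, r (x, y) -> r (y, x)) -> orbit r x y -> orbit r x = orbit r y.
Proof.
move=> rC oxy; apply/seteqP; split; last first.
  by apply: orbit_sub oxy; exact: orbit_invariant.
apply: orbit_sub; first exact: orbit_invariant.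
(* If [x] lay outside [orbit r y], the complement of that orbit would be an invariant set containing
   [x], hence also [y]. *)
apply: contrapT => nyx.
have iC := plus_invariantC rC (@orbit_invariant _ r y).
by apply: (orbit_sub iC nyx oxy); exact: orbit_refl.
Qed.

Lemma invariant_partition (X : topologicalType) (r : set (X * X)) :
  hausdorff_space X ->
  (forall x y, r (x, y) -> r (y, x)) ->
  (forall x, nbhs x [set y | r (x, y)]) ->
  (forall K, compact K -> exists2 C, compact C & rel_image r K `<=` C) ->
  exists Q : set (set X), partition Q id [set: X] /\
    forall A, Q A -> [/\ clopen A, sigma_compact A & plus_invariant r A].
Proof.
move=> hX rC rN rK; exists (range (orbit r)); split.
  split.
  - apply/seteqP; split=> // x _; exists (orbit r x); last exact: orbit_refl.
    by exists x.
  - move=> _ _ [x _ <-] [y _ <-] [z [xz yz]].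
    by rewrite (orbit_eq rC xz) (orbit_eq rC yz).
  - by move=> _ [x _ <-]; exists x; exact: orbit_refl.
move=> _ [x _ <-]; have iO := @orbit_invariant X r x.
have cO : closed (orbit r x).
  rewrite -openC; apply: plus_invariant_open rN _.
  exact: plus_invariantC.
split=> //; first by split=> //; exact: plus_invariant_open iO.
have /choice[g gP] : forall K, exists C, compact K ->
    compact C /\ rel_image r K `<=` C.
  move=> K.
  (* [set0] is a dummy value on non-compact sets, which makes [g] total so that it can be
     iterated. *)
  have [cK|ncK] := pselect (compact K); last by exists set0.
  by have [C cC sC] := rK K cK; exists C.
pose L n := iter n g [set x].
have cL n : compact (L n).
  by elim: n => [|n IH]; [exact: compact_set1|exact: (gP _ IH).1].
(* [g] may enlarge the image beyond the class, so each [L n] is cut back to it. The union of the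
   [L n] is [r]-invariant and contains [x], so nothing of the class is missed. *)
exists (fun n => L n `&` orbit r x).
  by move=> n; apply: compact_closedI.
rewrite -setI_bigcupl; apply/esym/setIidPr.
apply: orbit_sub; last by exists 0.
move=> z [y [n _ Lny] ryz]; exists n.+1 => //.
by apply: (gP _ (cL n)).2; exists y.
Qed.

(** * From paracompactness to invariant partitions *)

Lemma precompact_locally_finite_cover (X : topologicalType) :
  locally_compact [set: X] -> paracompact X ->
  exists V : set (set X), [/\ open_cover V, locally_finite V &
    forall A, V A -> exists2 C, compact C & A `<=` C].
Proof.
move=> lcX pX.
have [|V [oV VU fV]] :=
    pX [set A | open A /\ exists2 C, compact C & A `<=` C].
  split; first by move=> A [].
  apply/seteqP; split=> // x _.
  have [C xC cC] := locally_compact_compact_nbhs x lcX.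
  exists (interior C); last exact: xC.
  split; first exact: open_interior.
  by exists C => //; exact: interior_subset.
exists V; split=> // A /VU[B [_ [C cC BC]] AB]; exists C => //.
exact: subset_trans BC.
Qed.

Lemma proper_closed_partition (X : topologicalType) (f : set (X * X)) :
  locally_compact [set: X] -> hausdorff_space X -> paracompact X ->
  proper_closed_relation f ->
  exists Q : set (set X), partition Q id [set: X] /\
    forall A, Q A -> [/\ clopen A, sigma_compact A, plus_invariant f A
      & plus_invariant (f^-1)%relation A].
Proof.
move=> lcX hX pX [_ pf].
have [V [[Vop Vcov] Vfin Vpre]] := precompact_locally_finite_cover lcX pX.
pose r : set (X * X) := [set p | [\/ f p, (f^-1)%relation p |
  exists2 A, V A & A p.1 /\ A p.2]].
have rC x y : r (x, y) -> r (y, x).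
  by case=> [fxy|fyx|[A VA [Ax Ay]]];
    [constructor 2|constructor 1|constructor 3; exists A].
have rN x : nbhs x [set y | r (x, y)].
  have [A VA Ax] : cover V id x by rewrite Vcov.
  apply: (@filterS _ _ _ A) => [y Ay|]; first by constructor 3; exists A.
  by apply: open_nbhs_nbhs; split=> //; exact: Vop.
have rK K : compact K -> exists2 C, compact C & rel_image r K `<=` C.
  move=> cK.
  have [C cC VC] : exists2 C, compact C &
      \bigcup_(A in [set A | V A /\ A `&` K !=set0]) A `<=` C.
    apply: bigcup_sub_compact; last by move=> A [/Vpre].
    (* Meeting only finitely many members of [V] passes to subsets and finite unions, and holds near
       each point by local finiteness. *)
    apply: (@compact_ind X (fun S => finite_set [set A | V A /\ A `&` S !=set0]))
      cK.
    - by rewrite (_ : mkset _ = set0)// -subset0 => A [_ [x []]].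
    - move=> A B AB; apply: sub_finite_set => W [VW [x [Wx Ax]]].
      by split=> //; exists x; split=> //; exact: AB.
    - move=> A B fA fB; apply: (@sub_finite_set _ _
        ([set W | V W /\ W `&` A !=set0] `|` [set W | V W /\ W `&` B !=set0])).
        by move=> W [VW [x [Wx [Ax|Bx]]]]; [left|right]; split=> //; exists x.
      by rewrite finite_setU.
    - by move=> x _; exact: Vfin.
  exists (rel_image f K `|` rel_image (f^-1)%relation K `|` C).
    have [? ?] := pf K cK; apply: compactU => //; exact: compactU.
  move=> y [x Kx [fxy|fyx|[A VA [Ax Ay]]]].
  - by left; left; exists x.
  - by left; right; exists x.
  - by right; apply: VC; exists A => //; split=> //; exists x.
have [Q [pQ Qr]] := invariant_partition hX rC rN rK.
exists Q; split=> // A /Qr[clA sA iA]; split=> // y [x Ax fxy]; apply: iA.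
  by exists x => //; constructor 1.
by exists x => //; constructor 2.
Qed.

(** * Exhaustions, and from partitions back to paracompactness *)

Lemma compact_sub_interior_compact (X : topologicalType) (K : set X) :
  locally_compact [set: X] -> compact K ->
  exists2 C, compact C & K `<=` interior C.
Proof.
move=> lcX cK.
apply: (@compact_ind X (fun S => exists2 C, compact C & S `<=` interior C)) cK.
- by exists set0; [exact: compact0|exact: sub0set].
- by move=> A B AB [C cC BC]; exists C => //; exact: subset_trans BC.
- move=> A B [C cC AC] [D cD BD]; exists (C `|` D); first exact: compactU.
  move=> x [/AC|/BD]; apply: interiorS x; [exact: subsetUl|exact: subsetUr].
- move=> x _; have [C xC cC] := locally_compact_compact_nbhs x lcX.
  exists (interior C); last by exists C.
  by apply: open_nbhs_nbhs; split=> //; exact: open_interior.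
Qed.

Lemma sigma_compact_exhaustion (X : topologicalType) (A : set X) :
  locally_compact [set: X] -> sigma_compact A ->
  exists L : nat -> set X, [/\ L 0 = set0, forall n, compact (L n),
    forall n, L n `<=` interior (L n.+1) & A `<=` \bigcup_n L n].
Proof.
move=> lcX [K cK ->].
have /choice[g gP] : forall B : set X, exists C, compact B ->
    compact C /\ B `<=` interior C.
  move=> B.
  have [cB|ncB] := pselect (compact B); last by exists set0.
  by have [C cC sC] := compact_sub_interior_compact lcX cB; exists C.
(* Absorbing [L m] gives the nesting, absorbing [K m] the covering. *)
pose fix L n := if n is m.+1 then g (L m `|` K m) else set0.
have cL n : compact (L n).
  elim: n => [|n IH]; first exact: compact0.
  by apply: (gP _ _).1; exact: compactU.
have sL n : L n `|` K n `<=` interior (L n.+1).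
  by apply: (gP _ _).2; exact: compactU.
exists L; split=> //; first by move=> n; apply: subset_trans (sL n); left.
move=> x [n _ Knx]; exists n.+1 => //; apply: interior_subset.
by apply: sL; right.
Qed.

Lemma clopen_sigma_compact_refinement (X : topologicalType) (A : set X)
    (U : set (set X)) :
  locally_compact [set: X] -> hausdorff_space X ->
  clopen A -> sigma_compact A -> open_cover U ->
  exists V : set (set X), [/\ V `<=` open, refines V U,
    forall B, V B -> B `<=` A, A `<=` cover V id &
    forall x, A x -> exists2 N, nbhs x N &
      finite_set [set B | V B /\ B `&` N !=set0]].
Proof.
move=> lcX hX [oA cA] sA [Uop Ucov].
have [L [L0 cL sL AL]] := sigma_compact_exhaustion lcX sA.
(* For [n = 0] the truncated predecessor gives [L 0 = set0], so nothing is removed. Openness uses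
   that compact sets are closed in a Hausdorff space. *)
pose D n : set (set X) := [set u `&` (A `&` ~` L n.-1) | u in U].
have Dop n : D n `<=` open.
  move=> _ [u Uu <-]; apply: openI; first exact: Uop.
  by apply: openI => //; rewrite openC; exact: compact_closed.
have LS n x : L n.-1 x -> interior (L n) x.
  by case: n => [|n] /=; [rewrite L0|exact: sL].
have /choice[W WP] : forall n, exists W : set (set X),
    [/\ finite_set W, W `<=` D n &
      (L n.+1 `\` interior (L n)) `&` A `<=` cover W id].
  move=> n; apply: compact_finite_subcover => //.
    rewrite setDE -setIA; apply: compact_closedI => //.
    by apply: closedI => //; rewrite closedC; exact: open_interior.
  move=> x [[_ nLx] Ax].
  have [u Uu ux] : cover U id x by rewrite Ucov.
  by exists (u `&` (A `&` ~` L n.-1)); [exists u|split=> //; split=> // /LS].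
exists (\bigcup_n W n); split.
- by move=> B [n _ WnB]; have [_ /(_ _ WnB)/Dop] := WP n.
- move=> B [n _ WnB]; have [_ /(_ _ WnB)[u Uu <-] _] := WP n.
  by exists u => //; exact: subIsetl.
- by move=> B [n _ WnB]; have [_ /(_ _ WnB)[u Uu <-] _] := WP n; move=> x [_ []].
- move=> x Ax.
  (* The index at which [x] enters the exhaustion picks its shell; it exists because [L 0] is
     empty. *)
  have [n Ln Lm] : exists2 n, L n.+1 x & ~ L n x.
    have [m _ Lmx] := AL x Ax; elim: m Lmx => [|m IH]; first by rewrite L0.
    by have [/IH//|nLm ?] := pselect (L m x); exists m.
  have [_ _ /(_ x)[]] := WP n; first by split=> //; split=> // /interior_subset.
  by move=> B WB Bx; exists B => //; exists n.
- move=> x /AL[m _ /sL Lmx]; exists (interior (L m.+1)).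
    by apply: open_nbhs_nbhs; split=> //; exact: open_interior.
  (* For [n >= m.+2], members of [W n] avoid [L n.-1], which contains [L m.+1] and hence the chosen
     neighbourhood; only finitely many finite families remain. *)
  apply: (@sub_finite_set _ _ (\bigcup_(n in `I_m.+2) W n)); last first.
    by apply: bigcup_finite => // n _; have [] := WP n.
  have Lmono i j : (i <= j)%N -> L i `<=` L j.
    elim: j => [|j IH]; first by rewrite leqn0 => /eqP->.
    rewrite leq_eqVlt ltnS => /orP[/eqP->//|/IH ij].
    by apply: subset_trans ij _; apply: subset_trans (sL j) _;
      exact: interior_subset.
  move=> B [[n _ WnB] [y [By /interior_subset Ly]]]; exists n => //=.
  rewrite ltnNge; apply/negP => mn.
  have [_ /(_ _ WnB)[u _ uB] _] := WP n; move: By; rewrite -uB => -[_ [_]].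
  by apply; apply: Lmono Ly; case: n mn {WnB uB}.
Qed.

(** The refinements built on the separate pieces can be pooled: each piece is open, so a point has a
    neighbourhood inside its own piece, and this meets no set from the other pieces. *)
Lemma clopen_partition_paracompact (X : topologicalType) (Q : set (set X)) :
  locally_compact [set: X] -> hausdorff_space X ->
  partition Q id [set: X] ->
  (forall A, Q A -> clopen A /\ sigma_compact A) -> paracompact X.
Proof.
move=> lcX hX [covQ disjQ _] QP U oU.
have /choice[V VP] : forall A, exists V, Q A ->
    [/\ V `<=` open, refines V U,
      forall B, V B -> B `<=` A, A `<=` cover V id &
      forall x, A x -> exists2 N, nbhs x N &
        finite_set [set B | V B /\ B `&` N !=set0]].
  move=> A.
  have [QA|nQA] := pselect (Q A); last by exists set0.
  have [clA sA] := QP A QA.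
  have [W WP] := clopen_sigma_compact_refinement lcX hX clA sA oU.
  by exists W.
exists (\bigcup_(A in Q) V A); split.
- split; first by move=> B [A QA VB]; have [/(_ _ VB)] := VP A QA.
  apply/seteqP; split=> // x _.
  have [A QA Ax] : cover Q id x by rewrite covQ.
  have [_ _ _ /(_ _ Ax)[B VB Bx] _] := VP A QA.
  by exists B => //; exists A.
- by move=> B [A QA VB]; have [_ /(_ _ VB)] := VP A QA.
- move=> x; have [A QA Ax] : cover Q id x by rewrite covQ.
  have [_ _ _ _ /(_ _ Ax)[N xN fN]] := VP A QA.
  exists (N `&` A).
    apply: filterI => //; apply: open_nbhs_nbhs; split=> //.
    by have [[]] := QP A QA.
  apply: sub_finite_set fN => B [[A' QA' VB] [y [By [Ny Ay]]]].
  have [_ _ /(_ _ VB _ By) A'y _ _] := VP A' QA'.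
  have -> : A = A' by apply: disjQ => //; exists y.
  by split=> //; exists y.
Qed.

Theorem theorem8p1 (X : topologicalType)
    (lcX : locally_compact [set: X]) (hX : hausdorff_space X) :
  (paracompact X <->
     exists Q : set (set X),
       partition Q id [set: X] /\
       forall A, Q A -> clopen A /\ sigma_compact A) /\
  (paracompact X ->
     forall f : set (X * X), proper_closed_relation f ->
       exists Q : set (set X),
         partition Q id [set: X] /\
         forall A, Q A ->
           [/\ clopen A, sigma_compact A, plus_invariant f A
             & plus_invariant (f^-1)%relation A]).
Proof.
split; last by move=> pX f pf; exact: proper_closed_partition.
split=> [pX|[Q [pQ QP]]]; last exact: clopen_partition_paracompact pQ QP.
have p0 : proper_closed_relation (set0 : set (X * X)).
  split; first exact: closed0.
  have im0 A : rel_image (set0 : set (X * X)) A = set0.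
    by rewrite -subset0 => y [].
  by move=> A _; rewrite im0; split; exact: compact0.
have [Q [pQ QP]] := proper_closed_partition lcX hX pX p0.
by exists Q; split=> // A /QP[].
Qed.
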